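(* Let $d\ge1$ and $n>2d$ be integers and let $\Delta$ be a traceable pure $d$-dimensional simplicial complex on $n$ vertices. Suppose that every labeling that makes $\Delta$ weakly-traceable also makes $\Delta$ traceable. Let $\sigma_1,\dots,\sigma_s$ be the $(d-1)$-faces of $\Delta$, ordered so that $d_1\le d_2\le\dots\le d_s$, where $d_i$ is the number of $d$-faces of $\Delta$ containing $\sigma_i$. If for every integer $k$ with $d\le k<\frac n2$ one has $d_{k-d+1}>k$, then $\Delta$ is weakly-Hamiltonian.
   Context: A labeling of a simplicial complex with $n$ vertices is a bijection of its vertex set with $\{1,\dots,n\}$. Given a labeling, for $i\in\{1,\dots,n\}$ let $H_i$ be the $(d+1)$-element set $\{i,i+1,\dots,i+d\}$, where labels are read modulo $n$ (so $n+1$ means $1$, etc.). A labeling makes $\Delta$ traceable if $H_1,\dots,H_{n-d}$ are all faces of $\Delta$; $\Delta$ is traceable if some labeling makes it traceable. A labeling makes $\Delta$ weakly-traceable if there are indices $1\le i_1<\dots<i_k\le n-d$ such that $H_{i_1},\dots,H_{i_k}$ are faces of $\Delta$, together they cover all vertices, and $H_{i_j}\cap H_{i_{j+1}}\ne\emptyset$ for each $j\in\{1,\dots,k-1\}$. $\Delta$ is weakly-Hamiltonian if it has a labeling for which there are indices $1\le i_1<\dots<i_k\le n$ such that $H_{i_1},\dots,H_{i_k}$ are faces of $\Delta$, together they cover all vertices, $H_{i_j}\cap H_{i_{j+1}}\neq\emptyset$ for each $j\in\{1,\dots,k-1\}$, and $H_{i_k}\cap H_{i_1}\ne\emptyset$.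 *)

(* Defs.v *)
From mathcomp Require Import all_boot.
Set Implicit Arguments.
Unset Strict Implicit.
Unset Printing Implicit Defensive.

Section Defs.
Variable T : finType.
Implicit Types (D : {set {set T}}) (F G : {set T}).

(* An abstract simplicial complex, given by its set of faces (the empty face
   included), whose vertex set is the whole of T. *)
Definition simplicial_complex D :=
  (forall x : T, [set x] \in D) /\
  (forall F G, F \in D -> G \subset F -> G \in D).

Definition facet D F := maxset (fun G => G \in D) F.

Definition pure_dim D d := forall F, facet D F -> #|F| = d.+1.

(* k-dimensional faces, by cardinality: for k = d - 1 use [faces_card D d]. *)
Definition faces_card D m : {set {set T}} := [set F in D | #|F| == m].

(* The number of d-faces containing F. *)
Definition face_degree D d F := #|[set G in faces_card D d.+1 | F \subset G]|.

Variable n : nat.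

(* A labeling is a bijection lab : T -> 'I_n, so labels are shifted by one to
   0, ..., n - 1: the set H_i of the usual 1-based convention is
   [hset d lab (i - 1)], and the ranges 1 <= i <= n - d and 1 <= i <= n become
   i < n - d and i < n. *)
Definition hset d (lab : T -> 'I_n) (i : nat) : {set T} :=
  [set x | [exists j : 'I_d.+1, lab x == (i + j) %% n :> nat]].

Definition makes_traceable D d (lab : T -> 'I_n) :=
  forall i, i < n - d -> hset d lab i \in D.

(* s lists indices i_1 < ... < i_k below m. *)
Definition covering_chain D d (lab : T -> 'I_n) (m : nat) (s : seq nat) :=
  [/\ sorted ltn s,
      forall i, i \in s -> i < m /\ hset d lab i \in D,
      forall x : T, exists2 i, i \in s & x \in hset d lab i
    & sorted (fun i j => hset d lab i :&: hset d lab j != set0) s].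

Definition makes_weakly_traceable D d (lab : T -> 'I_n) :=
  exists s, covering_chain D d lab (n - d) s.

Definition traceable D d :=
  exists2 lab : T -> 'I_n, bijective lab & makes_traceable D d lab.

(* The default 0 of head and last is irrelevant when T is inhabited: s is then
   nonempty by the covering condition. *)
Definition weakly_Hamiltonian D d :=
  exists2 lab : T -> 'I_n, bijective lab &
  exists2 s, covering_chain D d lab n s &
    hset d lab (last 0 s) :&: hset d lab (head 0 s) != set0.

End Defs.

Arguments traceable {T} n D d.
Arguments weakly_Hamiltonian {T} n D d.

(* Main.v *)
(** This is Chvatal's degree argument with Posa rotations. Let [v_1 ... v_n] be
  a traceable labeling, [sigma = {v_1, ..., v_d}] and [tau] the last [d]
  vertices. If [sigma + v_{i+1}] and [tau + v_i] are both faces, then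
  [v_{i+1} ... v_n v_i ... v_1] is a weakly-Hamiltonian cycle. Otherwise
  [deg sigma + deg tau < n], and up to reversal [k = deg sigma < n/2]. For
  each face [sigma + v_{i+1}] with [i < n - d], the labeling
  [v_i ... v_1 v_{i+1} ... v_n] is weakly-traceable, hence traceable, and it
  starts with the [(d-1)]-face [{v_{i-d+1}, ..., v_i}]. If
  [deg sigma + deg tau] is maximal, all these faces have degree at most [k].
  There are at least [k - d + 1] of them: [i = n - d] is excluded because
  [tau + v_{n-d}] is a face, so at most [d - 1] of the [k] faces containing
  [sigma] are lost. This contradicts [d_{k-d+1} > k]. *)

Require Import Defs.
From mathcomp Require Import all_boot.
From mathcomp Require Import zify.

Section Labelings.
Variables (T : finType) (d n : nat) (D : {set {set T}}).
Hypotheses (d_gt0 : 0 < d) (d2_lt_n : 2 * d < n) (cardT : #|T| = n).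
Implicit Types (lab : T -> 'I_n) (x : T) (F : {set T}).

(** * Windows, relabelings and chains with a cut *)

Lemma mem_hset lab i x :
  i + d < n -> (x \in hset d lab i) = (i <= lab x <= i + d).
Proof.
move=> lt_id; rewrite inE; apply/existsP/idP => [[j /eqP ->]|le_x].
  by have lt_j := ltn_ord j; rewrite modn_small; lia.
have lt_d : lab x - i < d.+1 by lia.
by exists (Ordinal lt_d); rewrite /= modn_small; lia.
Qed.

(** The closed chain in [crossing_weakly_Hamiltonian] ends with this window, the only one there that
    wraps around. *)
Lemma mem_hset_wrap lab x :
  (x \in hset d lab (n - d)) = (n - d <= lab x) || (lab x == 0 :> nat).
Proof.
have lt_x := ltn_ord (lab x).
rewrite inE; apply/existsP/idP => [[j /eqP ->]|/orP[le_x|/eqP ->]].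
- have := ltn_ord j; rewrite ltnS leq_eqVlt => /orP[/eqP ->|lt_j].
    by rewrite subnK ?modnn ?eqxx ?orbT; lia.
  by rewrite modn_small; lia.
- have lt_d : lab x - (n - d) < d.+1 by lia.
  by exists (Ordinal lt_d); rewrite /= modn_small; lia.
- by exists ord_max; rewrite /= subnK ?modnn //; lia.
Qed.

Lemma relabel lab (f : nat -> nat) :
    bijective lab -> (forall l, l < n -> f l < n) ->
    (forall l m, l < n -> m < n -> f l = f m -> l = m) ->
  exists2 lab' : T -> 'I_n, bijective lab' & forall x, lab' x = f (lab x) :> nat.
Proof.
move=> bij_lab f_lt f_inj.
exists (fun x => Ordinal (f_lt _ (ltn_ord (lab x)))) => //.
apply: inj_card_bij; last by rewrite card_ord cardT.
move=> x y /(congr1 val) /= /f_inj eq_xy.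
by apply: (bij_inj bij_lab); apply: val_inj; apply: eq_xy.
Qed.

Lemma vertex_of_label lab i :
  bijective lab -> i < n -> exists x, lab x = i :> nat.
Proof. by case=> g _ gK lt_i; exists (g (Ordinal lt_i)); rewrite gK. Qed.

Lemma card_label_range lab a b :
  bijective lab -> b <= n -> #|[set x | a <= lab x < b]| = b - a.
Proof.
move=> bij_lab le_bn; have inj_lab := bij_inj bij_lab.
rewrite -(card_imset _ inj_lab) -[RHS]card_ord -[RHS]cardsT.
have lt_f (j : 'I_(b - a)) : a + j < n by have := ltn_ord j; lia.
rewrite -[RHS](card_imset _ (f := fun j => Ordinal (lt_f j))).
  apply: eq_card => i; apply/imsetP/imsetP => [[x]|[j _ ->]].
    rewrite inE => rng_x ->; have lt_x : lab x - a < b - a by lia.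
    by exists (Ordinal lt_x) => //; apply: val_inj => /=; lia.
  have [x def_x] := vertex_of_label lab (a + j) bij_lab (lt_f j).
  exists x; last exact: val_inj.
  by rewrite inE def_x; have := ltn_ord j; lia.
by move=> i j /(congr1 val) /= eq_ij; apply: val_inj => /=; lia.
Qed.

(* The windows from p - d + 1 to p - 1, those meeting both sides of the cut
   before label p other than the window p - d, are skipped. *)
Lemma covering_chain_cut lab p m b :
    bijective lab -> d <= p < m -> n - d <= m <= b ->
    (forall j, j < m -> (j <= p - d) || (p <= j) -> hset d lab j \in D) ->
  covering_chain D d lab b (iota 0 (p - d).+1 ++ iota p (m - p)).
Proof.
move=> bij_lab rng_p rng_m faceD.
have meet i j l r : l <= d -> r <= d -> (i + l) %% n = (j + r) %% n ->
    hset d lab i :&: hset d lab j != set0.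
  move=> le_l le_r eq_lr.
  have [x def_x] := vertex_of_label lab ((i + l) %% n) bij_lab
                      (ltn_pmod _ (leq_ltn_trans (leq0n _) d2_lt_n)).
  apply/set0Pn; exists x; rewrite !inE; apply/andP; split; apply/existsP.
    by exists (Ordinal (le_l : l < d.+1)); rewrite def_x.
  by exists (Ordinal (le_r : r < d.+1)); rewrite def_x eq_lr.
have path_iota (R : rel nat) : (forall i, R i i.+1) ->
    forall k i, path R i (iota i.+1 k).
  by move=> R_S; elim=> //= k IHk i; rewrite R_S IHk.
have sorted_cut (R : rel nat) : (forall i, R i i.+1) -> R (p - d) p ->
    sorted R (iota 0 (p - d).+1 ++ iota p (m - p)).
  move=> R_S R_p; rewrite /= cat_path path_iota //=.
  have -> : last 0 (iota 1 (p - d)) = p - d.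
    by rewrite -(nth_last 0) size_iota; case: (p - d) => // k; rewrite nth_iota.
  have : 0 < m - p by lia.
  by case: (m - p) => //= k _; rewrite R_p path_iota.
split.
- by apply: sorted_cut => //; lia.
- by move=> i; rewrite mem_cat !mem_iota => rng_i; split; [|apply: faceD]; lia.
- move=> x; have lt_x := ltn_ord (lab x).
  have cover j : j <= lab x <= j + d -> x \in hset d lab j.
    move=> rng_j; rewrite inE; apply/existsP.
    have lt_d : lab x - j < d.+1 by lia.
    by exists (Ordinal lt_d); rewrite /= modn_small; lia.
  have [le_xp|lt_px] := leqP (lab x) p.
    by exists (minn (lab x) (p - d));
       [rewrite mem_cat !mem_iota | apply: cover]; lia.
  (* The last window, [m.-1], reaches label [n.-1] because [n - d <= m]. *)
  by exists (minn (lab x) m.-1);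
     [rewrite mem_cat !mem_iota | apply: cover]; lia.
(* Windows [i] and [i.+1] share label [i + 1] modulo [n], as [d] is positive; at the cut, windows
   [p - d] and [p] share label [p]. *)
- apply: sorted_cut => [i|].
    by apply: (meet _ _ 1 0); rewrite // addn1 addn0.
  by apply: (meet _ _ d 0); rewrite // subnK ?addn0; lia.
Qed.

(** * Degrees as links; the two end faces *)

Definition link F := [set x | (x \notin F) && (x |: F \in D)].

(** A [d]-face containing [F] has exactly one vertex outside [F], and that vertex determines it. *)
Lemma face_degree_link F : #|F| = d -> face_degree D d F = #|link F|.
Proof.
move=> cardF; rewrite /face_degree -[RHS](card_in_imset (f := fun x => x |: F)).
  apply: eq_card => G; rewrite !inE; apply/andP/imsetP => [[]|[x]].
    case/andP=> DG /eqP cardG sFG.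
    have /eqP/cards1P[x def_x] : #|G :\: F| = 1.
      by rewrite cardsD (setIidPr sFG) cardG cardF subSnn.
    have def_G : G = x |: F by rewrite -def_x setUC -[LHS](setID G F) (setIidPr sFG).
    have : x \in G :\: F by rewrite def_x set11.
    case/setDP=> _ notFx.
    by exists x; rewrite // inE notFx -def_G.
  rewrite !inE => /andP[notFx DxF] ->.
  by rewrite DxF cardsU1 notFx cardF eqxx subsetUr.
move=> x y; rewrite !inE => /andP[notFx _] /andP[_ _] /setP/(_ x).
by rewrite !inE eqxx (negPf notFx) !orbF => /esym/eqP.
Qed.

Definition head_face lab := [set x | lab x < d].
Definition tail_face lab := [set x | n - d <= lab x].

Lemma card_head_face lab : bijective lab -> #|head_face lab| = d.
Proof.
by move=> bij_lab; rewrite -[RHS](subn0 d) -(card_label_range lab 0 d) //; lia.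
Qed.

Lemma card_tail_face lab : bijective lab -> #|tail_face lab| = d.
Proof.
move=> bij_lab; have -> : tail_face lab = [set x | n - d <= lab x < n].
  by apply/setP=> x; rewrite !inE ltn_ord andbT.
by rewrite card_label_range //; lia.
Qed.

(** * Crossing, rotation and reversal of a traceable labeling *)

(* Labels start at 0, so x is v_{i+1} and y is v_i for i = lab x. *)
Lemma crossing_weakly_Hamiltonian lab x y :
    bijective lab -> makes_traceable D d lab -> lab x = (lab y).+1 :> nat ->
    x \in link (head_face lab) -> y \in link (tail_face lab) ->
  weakly_Hamiltonian n D d.
Proof.
move=> bij_lab tr_lab def_x; rewrite !inE => /andP[le_dx Dx] /andP[lt_y Dy].
have inj_lab := bij_inj bij_lab; have ltx := ltn_ord (lab x).
have eq_lab z t : (z == t) = (lab z == lab t :> nat).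
  by rewrite (inj_eq val_inj) (inj_eq inj_lab).
(* The part from [x] on comes first, then the part up to [y], reversed. Now [y] has label
   [n - lab x], so the window ending at the cut is [y |: tail_face lab]; the window [n - d] wraps
   around to [x] and is [x |: head_face lab]. *)
pose f l := if l < lab x then n.-1 - l else l - lab x.
have [] := relabel lab f bij_lab.
- by move=> l lt_l; rewrite /f; case: ifP; lia.
- by move=> l m lt_l lt_m; rewrite /f; case: ifP; case: ifP; lia.
move=> lab' bij_lab' def_lab'; exists lab' => //.
(* The bound [(n - d).+1] admits the wrapping window, which contains the vertex now labeled 0 and so
   meets window 0. *)
exists (iota 0 (n - lab x - d).+1 ++ iota (n - lab x) ((n - d).+1 - (n - lab x))).
  apply: covering_chain_cut => //; [lia | lia |].
  move=> j lt_j cut_j; have [lt_jd | ge_jd] := ltnP j (n - d); last first.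
    have -> : j = n - d by lia.
    rewrite (_ : hset _ _ _ = x |: head_face lab) //.
    apply/setP=> z; rewrite mem_hset_wrap !inE def_lab' eq_lab /f.
    by have := ltn_ord (lab z); case: ifP; lia.
  have [lt_jp | ge_jp] := ltnP j (n - lab x).
    have [lt_jpd | ge_jpd] := ltnP j (n - lab x - d).
      rewrite (_ : hset _ _ _ = hset d lab (j + lab x)); first by apply: tr_lab; lia.
      apply/setP=> z; rewrite !mem_hset ?def_lab' /f; try lia.
      by have := ltn_ord (lab z); case: ifP; lia.
    rewrite (_ : hset _ _ _ = y |: tail_face lab) //.
    apply/setP=> z; rewrite mem_hset ?def_lab' /f; last lia.
    by rewrite !inE eq_lab; have := ltn_ord (lab z); case: ifP; lia.
  rewrite (_ : hset _ _ _ = hset d lab (n.-1 - j - d)); first by apply: tr_lab; lia.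
  apply/setP=> z; rewrite !mem_hset ?def_lab' /f; try lia.
  by have := ltn_ord (lab z); case: ifP; lia.
have [z def_z] := vertex_of_label lab' 0 bij_lab' (leq_ltn_trans (leq0n _) ltx).
apply/set0Pn; exists z; rewrite in_setI.
have -> : last 0 (iota 0 (n - lab x - d).+1 ++
    iota (n - lab x) ((n - d).+1 - (n - lab x))) = n - d.
  by rewrite last_cat -nth_last size_iota nth_iota; lia.
by rewrite mem_hset_wrap def_z eqxx orbT /= mem_hset; lia.
Qed.

(** Reversing the labels before [x] turns the window that ends at [x] into [x |: head_face lab]; the
    other windows of the chain are windows of [lab]. Since [lab x < n - d], some admissible window
    still starts at the cut. *)
Lemma rotation lab x :
    (forall lab', bijective lab' ->
       makes_weakly_traceable D d lab' -> makes_traceable D d lab') ->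
    bijective lab -> makes_traceable D d lab ->
    x \in link (head_face lab) -> lab x < n - d ->
  exists lab', [/\ bijective lab', makes_traceable D d lab',
    head_face lab' = [set y | lab x - d <= lab y < lab x]
    & tail_face lab' = tail_face lab].
Proof.
move=> weak_tr bij_lab tr_lab; rewrite !inE => /andP[le_dx Dx] lt_x.
have eq_lab z t : (z == t) = (lab z == lab t :> nat).
  by rewrite (inj_eq val_inj) (inj_eq (bij_inj bij_lab)).
pose f l := if l < lab x then (lab x).-1 - l else l.
have [] := relabel lab f bij_lab.
- by move=> l lt_l; rewrite /f; case: ifP; lia.
- by move=> l m lt_l lt_m; rewrite /f; case: ifP; case: ifP; lia.
move=> lab' bij_lab' def_lab'; exists lab'; split => //.
- apply: weak_tr => //; exists (iota 0 (lab x - d).+1 ++ iota (lab x) (n - d - lab x)).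
  apply: covering_chain_cut => //; [lia | lia |].
  move=> j lt_j cut_j; have [lt_jp | ge_jp] := ltnP j (lab x).
    have [lt_jpd | ge_jpd] := ltnP j (lab x - d).
      rewrite (_ : hset _ _ _ = hset d lab ((lab x).-1 - j - d)).
        by apply: tr_lab; lia.
      apply/setP=> z; rewrite !mem_hset ?def_lab' /f; try lia.
      by case: ifP; lia.
    rewrite (_ : hset _ _ _ = x |: head_face lab) //.
    apply/setP=> z; rewrite mem_hset ?def_lab' /f; last lia.
    by rewrite !inE eq_lab; case: ifP; lia.
  rewrite (_ : hset _ _ _ = hset d lab j); first exact: tr_lab.
  by apply/setP=> z; rewrite !mem_hset ?def_lab' /f; try lia; case: ifP; lia.
- by apply/setP=> z; rewrite !inE def_lab' /f; case: ifP; lia.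
- by apply/setP=> z; rewrite !inE def_lab' /f; case: ifP; lia.
Qed.

Lemma reversal lab :
    bijective lab -> makes_traceable D d lab ->
  exists lab', [/\ bijective lab', makes_traceable D d lab',
    head_face lab' = tail_face lab & tail_face lab' = head_face lab].
Proof.
move=> bij_lab tr_lab.
have [] := relabel lab (fun l => n.-1 - l) bij_lab; [lia | lia |].
move=> lab' bij_lab' def_lab'; exists lab'; split => //.
- move=> j lt_j; rewrite (_ : hset _ _ _ = hset d lab (n.-1 - j - d)).
    by apply: tr_lab; lia.
  apply/setP=> z; rewrite !mem_hset ?def_lab'; try lia.
  by have := ltn_ord (lab z); lia.
- by apply/setP=> z; rewrite !inE def_lab'; have := ltn_ord (lab z); lia.
- by apply/setP=> z; rewrite !inE def_lab'; have := ltn_ord (lab z); lia.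
Qed.

(** * Degree sums and faces of low degree *)

Lemma head_face_in_complex lab :
  simplicial_complex D -> makes_traceable D d lab -> head_face lab \in D.
Proof.
case=> _ down_closed tr_lab; apply: (down_closed (hset d lab 0)).
  by apply: tr_lab; lia.
by apply/subsetP=> x; rewrite mem_hset ?inE; lia.
Qed.

(** Shift the labels of the tail link by one. A label common to this set and the labels of the head
    link gives a crossing; otherwise the two sets are disjoint, and both miss label 0. *)
Lemma link_sum_lt lab :
    bijective lab -> makes_traceable D d lab ->
  weakly_Hamiltonian n D d \/
  #|link (head_face lab)| + #|link (tail_face lab)| < n.
Proof.
move=> bij_lab tr_lab; have inj_lab := bij_inj bij_lab.
set A := link (head_face lab); set B := link (tail_face lab).
have inj_succ : injective (@ordS n \o lab) := inj_comp (@ordS_inj n) inj_lab.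
have succ_lab y : y \in B -> ordS (lab y) = (lab y).+1 :> nat.
  by rewrite !inE => /andP[lt_y _] /=; rewrite modn_small; lia.
have [dis|] := boolP [disjoint lab @: A & (@ordS n \o lab) @: B]; last first.
  case/pred0Pn=> i /andP[/imsetP[x Ax ->] /imsetP[y By /(congr1 val) eq_xy]].
  left; apply: (crossing_weakly_Hamiltonian lab x y) => //.
  by rewrite -succ_lab.
right; have n_gt0 : 0 < n by lia.
rewrite -(card_imset _ inj_lab) -(card_imset _ inj_succ) -cardsUI.
move: dis; rewrite -setI_eq0 => /eqP->; rewrite cards0 addn0.
rewrite -[X in _ < X]card_ord -cardsT proper_card //.
rewrite properEneq subsetT andbT; apply/eqP=> /setP/(_ (Ordinal n_gt0)).
rewrite !inE => /orP[/imsetP[x Ax]|/imsetP[y By]] /(congr1 val) /=.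
  by move: Ax; rewrite !inE => /andP[]; lia.
by have /= -> := succ_lab y By.
Qed.

(** One step in maximizing the degree sum: every rotation keeps the tail, so either one of them
    gains degree at the head, or all the new heads have low degree. The last alternative denies the
    condition on [d_{k-d+1}]. *)
Lemma rotation_step lab :
    simplicial_complex D ->
    (forall lab', bijective lab' ->
       makes_weakly_traceable D d lab' -> makes_traceable D d lab') ->
    bijective lab -> makes_traceable D d lab ->
    #|link (head_face lab)| <= #|link (tail_face lab)| ->
  [\/ weakly_Hamiltonian n D d,
      exists lab', [/\ bijective lab', makes_traceable D d lab',
        tail_face lab' = tail_face lab
        & #|link (head_face lab)| < #|link (head_face lab')|]
    | exists k, [/\ d <= k, 2 * k < n &
        k - d < #|[set F in faces_card D d | face_degree D d F <= k]|]].
Proof.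
move=> cplxD weak_tr bij_lab tr_lab le_ht; have inj_lab := bij_inj bij_lab.
have [|sum_lt] := link_sum_lt lab bij_lab tr_lab; first by constructor 1.
set A := link (head_face lab) in le_ht sum_lt *.
(* The degree condition starts at [k = d], where a single face of degree at most [d] suffices: the
   head itself. *)
have [k_lt_d | d_le_k] := ltnP #|A| d.
  constructor 3; exists d; split=> //; rewrite subnn card_gt0.
  apply/set0Pn; exists (head_face lab).
  rewrite !inE head_face_in_complex // card_head_face // eqxx.
  by rewrite face_degree_link ?card_head_face // ltnW.
(* No rotation is available at label [n - d], but there the preceding vertex together with the tail
   forms the last window of [lab], which gives a crossing. *)
have [/exists_inP[x Ax /eqP def_x]|no_cross] :=
    boolP [exists x in A, lab x == n - d :> nat].
  constructor 1; have lt_y : n - d.+1 < n by lia.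
  have [y def_y] := vertex_of_label lab _ bij_lab lt_y.
  apply: (crossing_weakly_Hamiltonian lab x y) => //; first lia.
  rewrite !inE def_y (_ : y |: _ = hset d lab (n - d.+1)); last first.
    apply/setP=> z; rewrite mem_hset ?inE; last lia.
    rewrite -(inj_eq inj_lab) -(inj_eq val_inj) /= def_y.
    by have := ltn_ord (lab z); lia.
  by rewrite tr_lab; lia.
pose A0 := A :&: [set x | lab x < n - d].
pose s x := [set y | lab x - d <= lab y < lab x].
have A_ge x : x \in A0 -> d <= lab x < n - d.
  by rewrite !inE -leqNgt -andbA => /and3P[-> _ ->].
have [low|] := boolP [forall (x | x \in A0), #|link (s x)| <= #|A|]; last first.
  case/forall_inPn=> x A0x; rewrite -ltnNge => lt_A.
  have [Ax lt_x] : x \in A /\ lab x < n - d.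
    by move: A0x; rewrite in_setI inE => /andP.
  have [lab' [bij_lab' tr_lab' hd_lab' tl_lab']] :=
    rotation lab x weak_tr bij_lab tr_lab Ax lt_x.
  by constructor 2; exists lab'; split=> //; rewrite hd_lab'.
constructor 3; exists #|A|; split=> //; first by lia.
(* The largest label in [s x] is [(lab x).-1], so [s x] determines [x]. *)
have inj_s : {in A0 &, injective s}.
  move=> x y /A_ge rng_x /A_ge rng_y /setP eq_s.
  have [lt_x lt_y] : (lab x).-1 < n /\ (lab y).-1 < n by lia.
  have [x' def_x'] := vertex_of_label lab _ bij_lab lt_x.
  have [y' def_y'] := vertex_of_label lab _ bij_lab lt_y.
  have := eq_s x'; have := eq_s y'; rewrite !inE def_x' def_y' => eq1 eq2.
  by apply: inj_lab; apply: val_inj => /=; lia.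
apply: (@leq_trans #|s @: A0|); last first.
  apply/subset_leq_card/subsetP=> _ /imsetP[x A0x ->].
  have rng_x := A_ge x A0x; have lt_x := ltn_ord (lab x).
  have card_s : #|s x| = d by rewrite card_label_range //; lia.
  rewrite !inE card_s eqxx face_degree_link // (forall_inP low) // !andbT.
  case: cplxD => _ /(_ (hset d lab (lab x - d))); apply.
    by apply: tr_lab; lia.
  by apply/subsetP=> y; rewrite mem_hset ?inE; lia.
rewrite (card_in_imset inj_s).
have card_top : #|[set x | n - d < lab x < n]| = d.-1.
  by rewrite card_label_range //; lia.
(* With label [n - d] excluded, only the [d.-1] labels above it can be lost from [A]. *)
have : #|A| <= #|A0| + #|[set x | n - d < lab x < n]|.
  apply: leq_trans (leq_card_setU _ _).1; apply/subset_leq_card/subsetP=> x Ax.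
  rewrite in_setU in_setI Ax !inE ltn_ord andbT /=.
  have : lab x != n - d :> nat.
    by apply: contra no_cross => eq_x; apply/exists_inP; exists x.
  lia.
by rewrite card_top; lia.
Qed.

Lemma rotate_to_low_degrees lab :
    simplicial_complex D ->
    (forall lab', bijective lab' ->
       makes_weakly_traceable D d lab' -> makes_traceable D d lab') ->
    bijective lab -> makes_traceable D d lab ->
  weakly_Hamiltonian n D d \/
  exists k, [/\ d <= k, 2 * k < n &
    k - d < #|[set F in faces_card D d | face_degree D d F <= k]|].
Proof.
move=> cplxD weak_tr.
pose weight lab := #|link (head_face lab)| + #|link (tail_face lab)|.
(* Each link has at most [#|T|] vertices, so this difference drops strictly whenever [weight]
   grows. *)
have [m] := ubnP (2 * #|T| - weight lab).
elim: m lab => // m IHm lab le_m bij_lab tr_lab.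
(* Reversal swaps the end faces and preserves [weight]. *)
wlog le_ht : lab le_m bij_lab tr_lab /
    #|link (head_face lab)| <= #|link (tail_face lab)|.
  move=> wlog_ht.
  have [|/ltnW le_th] := leqP #|link (head_face lab)| #|link (tail_face lab)|.
    exact: wlog_ht.
  have [lab' [bij_lab' tr_lab' hd_lab' tl_lab']] := reversal lab bij_lab tr_lab.
  apply: (wlog_ht lab') => //; last by rewrite hd_lab' tl_lab'.
  by rewrite /weight hd_lab' tl_lab' addnC.
have [| |] := rotation_step lab cplxD weak_tr bij_lab tr_lab le_ht; [by left| |by right].
case=> lab' [bij_lab' tr_lab' tl_lab' lt_hd]; apply: (IHm lab') => //.
have le_card F : #|link F| <= #|T| := max_card _.
have := le_card (head_face lab'); have := le_card (tail_face lab).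
by move: le_m; rewrite /weight tl_lab'; lia.
Qed.

End Labelings.

(** * Reading the bound off the sorted degree sequence *)

Lemma card_le_sorted (T : finType) (S : {set T}) (g : T -> nat) s k m :
    uniq s -> s =i S -> sorted leq (map g s) -> k < nth 0 (map g s) m ->
  #|[set x in S | g x <= k]| <= m.
Proof.
move=> uniq_s s_S sorted_s lt_k.
have -> : #|[set x in S | g x <= k]| = count (fun i => i <= k) (map g s).
  rewrite count_map -size_filter -(card_uniqP (filter_uniq _ uniq_s)).
  by apply: eq_card => x; rewrite !inE mem_filter s_S andbC.
move: (map g s) sorted_s lt_k => t sorted_t lt_k.
(* Past the end, [nth] would return 0, which is not above [k]. *)
have lt_m : m < size t.
  by rewrite ltnNge; apply/negP=> /(nth_default 0) t_m; rewrite t_m in lt_k.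
rewrite -(cat_take_drop m t) count_cat.
(* From position [m] on, sortedness keeps every entry above [k]. *)
have /eqP -> : count (fun i => i <= k) (drop m t) == 0.
  rewrite -leqn0 leqNgt -has_count -all_predC.
  have := drop_sorted m sorted_t; rewrite (drop_nth 0) //= -ltnNge lt_k /=.
  move/(order_path_min leq_trans); apply: sub_all => i /= le_i.
  by rewrite -ltnNge (leq_trans lt_k).
by rewrite addn0 (leq_trans (count_size _ _)) // size_take lt_m.
Qed.

Theorem theorem2 (T : finType) (d n : nat) (D : {set {set T}})
    (sigma : seq {set T}) :
  1 <= d -> 2 * d < n -> #|T| = n ->
  simplicial_complex D -> pure_dim D d -> traceable n D d ->
  (forall lab : T -> 'I_n, bijective lab ->
     makes_weakly_traceable D d lab -> makes_traceable D d lab) ->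
  uniq sigma -> sigma =i faces_card D d ->
  sorted leq [seq face_degree D d F | F <- sigma] ->
  (forall k, d <= k -> 2 * k < n ->
     k < nth 0 [seq face_degree D d F | F <- sigma] (k - d)) ->
  weakly_Hamiltonian n D d.
Proof.
move=> d_gt0 lt_dn cardT cplxD _ [lab bij_lab tr_lab] weak_tr.
move=> uniq_s mem_s sorted_s deg_s.
have [|[k [le_dk lt_kn]]] // :=
  rotate_to_low_degrees T d n D d_gt0 lt_dn cardT lab cplxD weak_tr bij_lab tr_lab.
rewrite ltnNge; case/negP.
(* Positions count from 0, so the entry at [k - d] is [d_{k-d+1}]. *)
exact: card_le_sorted uniq_s mem_s sorted_s (deg_s k le_dk lt_kn).
Qed.
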